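(* Let $m,n,d,e$ be positive integers with $m=2n$ and $e=\gcd(n,d)=\gcd(m,d)$, and let $s\ge i\ge1$ be integers. Then \[|V_{s,i}|=2^{mi}\sum_{u=0}^{i}\binom{i}{u}_{2^e}2^{eu(u+1)/2}\prod_{j=0}^{u-1}(1-2^{ej-m}).\]
   Context: For integers $s\ge0$ and $i\ge1$, $V_{s,i}$ denotes the set of solutions $(x_1,\dots,x_{2i})\in\mathbb{F}_{2^m}^{2i}$ of the system \[\sum_{l=1}^i\big(x_{2l-1}x_{2l}^{2^{(\frac{n}{e}-j)d}}+x_{2l-1}^{2^{(\frac{n}{e}-j)d}}x_{2l}\big)=0,\qquad j=0,1,\dots,s.\] $\binom{a}{b}_q$ is the Gaussian binomial coefficient. *)

(* Defs.v *)
From mathcomp Require Import all_boot all_order all_algebra all_field.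
Set Implicit Arguments. Unset Strict Implicit. Unset Printing Implicit Defensive.
Import Order.TTheory GRing.Theory Num.Theory.
Local Open Scope ring_scope.

(* Exponent of the Frobenius twist x |-> x^(2^((n/e - j) d)) in a field with
   2^m elements.  Since x^(2^m) = x, the integer (n/e - j) d (possibly
   negative) is reduced modulo m. *)
Definition frob_exp (m n d e j : nat) : nat :=
  2 ^ absz (modz (((n %/ e)%:Z - j%:Z) * d%:Z) m%:Z).

(* Q_j(x) = sum_{l=1}^i (x_{2l-1} x_{2l}^{q_j} + x_{2l-1}^{q_j} x_{2l}),
   with 0-based indices x_{2l}, x_{2l+1}, l = 0..i-1. *)
Definition Qform (F : fieldType) (i : nat) (x : seq F) (q : nat) : F :=
  \sum_(l < i) (x`_(2 * l) * x`_(2 * l).+1 ^+ q + x`_(2 * l) ^+ q * x`_(2 * l).+1).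

Definition V_set (F : finFieldType) (m n d e s i : nat) : {set (2 * i).-tuple F} :=
  [set x : (2 * i).-tuple F |
     [forall j : 'I_s.+1, Qform i x (frob_exp m n d e j) == 0]].

Definition gauss_binom (q a b : nat) : rat :=
  if (b <= a)%N then
    \prod_(k < b) (((q ^ (a - k))%:R - 1) / ((q ^ k.+1)%:R - 1))
  else 0.

(* Main.v *)
(* Let sigma be x |-> x^(2^d) on F, with fixed field K of order q = 2^e and
   sigma^(2n/e) = id.  For x, y in F^i put
     B_t = \sum_l (x_l sigma^t(y_l) - y_l sigma^t(x_l)).
   The equations say B_(n/e - j) = 0 for 0 <= j <= s; applying a power of sigma
   gives B_(n/e + j) = 0 as well, so B_t vanishes on 2s + 1 >= 2i consecutive t.
   A skew polynomial in sigma of degree at most 2i kills all the x_l and y_l,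
   which makes (B_t) satisfy a linear recurrence of order at most 2i; hence every
   B_t vanishes.  Whether this happens is then counted one pair (x_l, y_l) at a
   time: if x spans a K-space of dimension r and the entry a is prepended to x,
   the number of solutions y is multiplied by |F| when a lies in that span, and
   by q^(r+1) otherwise (the new entry of y must lie in the span of a and x, and
   each choice is absorbed by a shift of y along a).  So a fixed x of K-rank u
   has |F|^(i-u) q^(u(u+1)/2) solutions y, and the number of x of K-rank u is
   [i, u]_q \prod_(j < u) (|F| - q^j) by the Pascal rule. *)
Require Import Defs.
From HB Require Import structures.
From mathcomp Require Import all_boot all_order all_algebra all_field.
From mathcomp Require Import ring zify.
Import Order.TTheory GRing.Theory Num.Theory.
Local Open Scope ring_scope.

Set Implicit Arguments.
Unset Strict Implicit.
Unset Printing Implicit Defensive.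

(** * Rows and iterated morphisms *)

Section ConsRow.
Context {R : Type} {k : nat}.

Definition consr (a : R) (x : 'rV[R]_k) : 'rV[R]_k.+1 :=
  \row_l oapp (x 0) a (unlift ord0 l).

Lemma consr0 a x : consr a x 0 ord0 = a.
Proof. by rewrite mxE unlift_none. Qed.

Lemma consr_lift a x l : consr a x 0 (lift ord0 l) = x 0 l.
Proof. by rewrite mxE liftK. Qed.

Lemma consr_eta (x : 'rV[R]_k.+1) :
  consr (x 0 ord0) (\row_l x 0 (lift ord0 l)) = x.
Proof.
apply/rowP=> l; case: (unliftP ord0 l) => [j ->|->].
  by rewrite consr_lift mxE.
by rewrite consr0.
Qed.

End ConsRow.

(** The tail is the outer variable, so that the counts below can vary the first entry with the tail
    fixed. *)
Lemma sum_rV_consr {R : finType} {k} (f : 'rV[R]_k.+1 -> nat) :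
  (\sum_x f x = \sum_x \sum_a f (consr a x))%N.
Proof.
rewrite exchange_big pair_bigA /=.
rewrite (reindex (fun p : R * 'rV[R]_k => consr p.1 p.2)) //=.
exists (fun x => (x 0 ord0, \row_l x 0 (lift ord0 l))) => [[a x] _|x _].
  by congr pair; [rewrite consr0 | apply/rowP=> l; rewrite mxE consr_lift].
exact: consr_eta.
Qed.

Section IterMorphism.
Variables (F : nzRingType) (sigma : {rmorphism F -> F}) (t : nat).

Fact iter_is_zmod_morphism : zmod_morphism (iter t sigma).
Proof. by move=> x y; elim: t => //= u ->; rewrite rmorphB. Qed.

Fact iter_is_monoid_morphism : monoid_morphism (iter t sigma).
Proof.
by split=> [|x y]; elim: t => //= u ->; rewrite (rmorph1, rmorphM).
Qed.

HB.instance Definition _ :=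
  GRing.isZmodMorphism.Build F F (iter t sigma) iter_is_zmod_morphism.
HB.instance Definition _ :=
  GRing.isMonoidMorphism.Build F F (iter t sigma) iter_is_monoid_morphism.
End IterMorphism.

(** * Gaussian binomials *)

Lemma gauss_binom0 q k : gauss_binom q k 0 = 1.
Proof. by rewrite /gauss_binom big_ord0. Qed.

Lemma gauss_binom_small q k u : (k < u)%N -> gauss_binom q k u = 0.
Proof. by rewrite /gauss_binom ltnNge => /negPf ->. Qed.

Lemma gauss_binomSS q k u : (1 < q)%N ->
  gauss_binom q k.+1 u.+1 =
  (q ^ u.+1)%:R * gauss_binom q k u.+1 + gauss_binom q k u.
Proof.
move=> q1.
have nz n : (q ^ n.+1)%:R - 1 != 0 :> rat.
  rewrite subr_eq0 (eqr_nat _ _ 1) -(expn0 q) eqn_exp2l //.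
have [uk|ku] := leqP u k; last by rewrite !gauss_binom_small ?mulr0 ?addr0 // ltnW.
(* For [u = k] the default value 0 agrees with the product, whose last numerator is [q ^ 0 - 1]. *)
have -> : gauss_binom q k u.+1 =
    \prod_(j < u.+1) (((q ^ (k - j))%:R - 1) / ((q ^ j.+1)%:R - 1)).
  rewrite /gauss_binom; case: ltngtP uk => // -> _.
  by rewrite big_ord_recr /= subnn subrr mul0r mulr0.
have nzp n : \prod_(j < n) ((q ^ j.+1)%:R - 1) != 0 :> rat.
  by apply/prodf_neq0 => j _.
rewrite /gauss_binom ltnS uk !big_split /= !prodfV.
rewrite big_ord_recl [X in _ / X]big_ord_recr /= subn0 big_ord_recr.
under eq_bigr => j _ do rewrite /bump /= add1n subSS.
(* The Pascal rule now comes down to $q^{k+1}-1 = q^{u+1}(q^{k-u}-1) + (q^{u+1}-1)$. *)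
have -> : (q ^ k.+1)%:R = (q ^ u.+1)%:R * (q ^ (k - u))%:R :> rat.
  by rewrite -natrM -expnD addSn subnKC.
by rewrite [\prod_(i < u.+1) _]big_ord_recr /=; field; rewrite nzp nz.
Qed.

(** * Spans over the fixed field and twisted forms *)

Section TwistedForms.
Variables (F : finFieldType) (sigma : {rmorphism F -> F}).

Definition fixK : {set F} := [set a | sigma a == a].
Local Notation q := #|fixK|.

(** The span is a bare finite set; its dimension over [fixK] is read off from its cardinal, a power
    of [q]. *)
Definition spanK k (x : 'rV[F]_k) : {set F} :=
  [set \sum_l c 0 l * x 0 l | c : 'rV[F]_k in
     [set c : 'rV[F]_k | [forall l, c 0 l \in fixK]]].

Lemma spanKP k (x : 'rV_k) w :
  reflect (exists2 c : 'rV_k, forall l, sigma (c 0 l) = c 0 l &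
             w = \sum_l c 0 l * x 0 l) (w \in spanK x).
Proof.
apply: (iffP imsetP) => [[c + ->]|[c Kc ->]].
  by rewrite inE => /forallP Kc; exists c => // l; have := Kc l; rewrite inE => /eqP.
by exists c => //; rewrite inE; apply/forallP=> l; rewrite inE Kc.
Qed.

Lemma spanK_consrP k a (x : 'rV_k) w :
  reflect (exists2 b, sigma b = b & w - b * a \in spanK x)
          (w \in spanK (consr a x)).
Proof.
apply: (iffP (spanKP _ _)) => [[c Kc ->]|[b Kb /spanKP[c Kc /(canRL (subrK _)) ->]]].
  exists (c 0 ord0) => //; apply/spanKP; exists (\row_l c 0 (lift ord0 l)).
    by move=> l; rewrite mxE.
  rewrite big_ord_recl consr0 addrC addKr.
  by apply: eq_bigr => l _; rewrite consr_lift mxE.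
exists (consr b c) => [l|].
  by case: (unliftP ord0 l) => [j ->|->]; rewrite ?consr_lift ?consr0.
rewrite big_ord_recl !consr0 addrC; congr (_ + _).
by apply: eq_bigr => l _; rewrite !consr_lift.
Qed.

Lemma spanK_subr k (x : 'rV_k) v w b : sigma b = b ->
  v \in spanK x -> w - b * v \in spanK x -> w \in spanK x.
Proof.
move=> Kb /spanKP[c Kc ->] /spanKP[c' Kc' /(canRL (subrK _)) ->].
apply/spanKP; exists (c' + b *: c) => [l|].
  by rewrite !mxE rmorphD rmorphM Kb Kc Kc'.
rewrite mulr_sumr -big_split; apply: eq_bigr => l _ /=.
by rewrite !mxE mulrDl mulrA.
Qed.

Lemma mem_spanK k (x : 'rV_k) l : x 0 l \in spanK x.
Proof.
apply/spanKP; exists (delta_mx 0 l) => [j|].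
  by rewrite mxE; case: (_ && _); rewrite ?rmorph1 ?rmorph0.
rewrite (bigD1 l) //= big1 ?addr0 => [|j /negPf jl].
  by rewrite !mxE !eqxx mul1r.
by rewrite !mxE jl mul0r.
Qed.

Lemma spanK_consr_in k a (x : 'rV_k) : a \in spanK x ->
  spanK (consr a x) = spanK x.
Proof.
move=> xa; apply/setP=> w; apply/spanK_consrP/idP => [[b Kb]|xw].
  exact: spanK_subr.
by exists 0; rewrite ?rmorph0 // mul0r subr0.
Qed.

Lemma card_spanK_consr k a (x : 'rV_k) : a \notin spanK x ->
  #|spanK (consr a x)| = (q * #|spanK x|)%N.
Proof.
move=> xNa.
have -> : spanK (consr a x) =
  [set p.1 * a + p.2 | p in setX fixK (spanK x)].
  apply/setP=> w; apply/spanK_consrP/imsetP => [[b Kb xw]|[[b v]]].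
    by exists (b, w - b * a); rewrite ?inE ?Kb ?eqxx //= addrC subrK.
  rewrite !inE /= => /andP[/eqP Kb xv] ->; exists b => //.
  by rewrite addrC addKr.
rewrite card_in_imset ?cardsX // => -[b v] [b' v'].
rewrite !inE /= => /andP[/eqP Kb /spanKP[c Kc ->]].
case/andP=> /eqP Kb' /spanKP[c' Kc' ->] E.
have [bb|/negPf nb] := eqVneq b b'.
  by move: E; rewrite bb => /addrI ->.
move: E => /eqP; rewrite -subr_eq0 opprD addrACA -mulrBl => /eqP /(canRL (addrK _)).
rewrite add0r => E; case/negP: xNa; apply/spanKP.
(* Two representations with [b != b'] can be solved for [a], which would put it in the span. *)
exists ((b - b')^-1 *: (c' - c)) => [l|].
  by rewrite !mxE rmorphM fmorphV !rmorphB Kb Kb' Kc Kc'.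
apply: (mulfI (_ : b - b' != 0)); first by rewrite subr_eq0 nb.
rewrite E opprB mulr_sumr -sumrB; apply: eq_bigr => l _.
by rewrite !mxE -mulrA mulVKf ?subr_eq0 ?nb // mulrBl.
Qed.

(** * Skew polynomials and annihilators of spans *)

(* The skew polynomial [\sum_k p_k sigma^k], viewed as an operator on [F]. *)
Definition sev (p : {poly F}) (w : F) := \sum_(k < size p) p`_k * iter k sigma w.

Lemma sev_wide n (p : {poly F}) w : (size p <= n)%N ->
  sev p w = \sum_(k < n) p`_k * iter k sigma w.
Proof.
move=> pn; rewrite /sev (big_ord_widen n (fun k => p`_k * iter k sigma w)) // big_mkcond.
apply: eq_bigr => k _; case: ifP => // /negbT.
by rewrite -leqNgt => /(nth_default 0) ->; rewrite mul0r.
Qed.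

Lemma sevB p : {morph sev p : x y / x - y}.
Proof.
by move=> x y; rewrite -sumrB; apply: eq_bigr => k _; rewrite rmorphB mulrBr.
Qed.

Lemma iter_fixK b t : sigma b = b -> iter t sigma b = b.
Proof. by move=> Kb; elim: t => //= t ->. Qed.

Lemma sev_fixM p b x : sigma b = b -> sev p (b * x) = b * sev p x.
Proof.
move=> Kb; rewrite mulr_sumr; apply: eq_bigr => k _.
by rewrite rmorphM /= (iter_fixK k Kb) mulrCA.
Qed.

(** Left composition with [a sigma - b]: composing [sigma] with [p] twists the coefficients of [p]
    and raises their degree by one. *)
Lemma sev_twist (p : {poly F}) a b w :
  sev (a *: (map_poly sigma p * 'X) - b *: p) w = a * sigma (sev p w) - b * sev p w.
Proof.
have sz : (size (a *: (map_poly sigma p * 'X) - b *: p)%R <= (size p).+1)%N.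
  rewrite (leq_trans (size_polyD _ _)) // geq_max size_polyN.
  rewrite (leq_trans (size_scale_leq _ _)) ?(leq_trans (size_scale_leq _ _)) //.
  by rewrite (leq_trans (size_polyMleq _ _)) // size_polyX addn2 size_map_poly.
rewrite (sev_wide _ sz) (sev_wide _ (leqnSn _)).
under eq_bigr => k _ do rewrite coefB !coefZ coefMX coef_map mulrBl -!mulrA.
rewrite sumrB -!mulr_sumr; congr (_ * _ - _).
rewrite big_ord_recl /= mul0r add0r big_ord_recr /= nth_default // mul0r addr0.
by rewrite rmorph_sum; apply: eq_bigr => k _; rewrite rmorphM.
Qed.

(** Induction on the entries. If [u = sev p a] is nonzero, then $(u\sigma - \sigma(u))p$ kills [w]
    exactly when [b = sev p w / u] is fixed by [sigma], that is, when [p] kills [w - b * a]; degree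
    and dimension both grow by one. *)
Lemma annihilator k (x : 'rV_k) : exists p : {poly F},
  [/\ (0 < size p <= k.+1)%N, #|spanK x| = (q ^ (size p).-1)%N &
      forall w, (sev p w == 0) = (w \in spanK x)].
Proof.
elim: k x => [|k IH] x; last first.
  rewrite -[x]consr_eta; move: (x 0 ord0) (\row_l _) => a {}x.
  have [p [/andP[p0 pk] cx px]] := IH x.
  have [xa|xNa] := boolP (a \in spanK x).
    by exists p; rewrite spanK_consr_in // p0 leqW.
  pose u := sev p a; have u0 : u != 0 by rewrite px.
  have su0 : sigma u != 0 by rewrite fmorph_eq0.
  have sz : size (u *: (map_poly sigma p * 'X) - sigma u *: p) = (size p).+1.
    have e1 : size (u *: (map_poly sigma p * 'X)) = (size p).+1.
      rewrite size_scale // size_mulX ?size_map_poly //.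
      by rewrite -size_poly_eq0 size_map_poly -lt0n.
    by rewrite size_polyDl e1 // size_polyN size_scale.
  exists (u *: (map_poly sigma p * 'X) - sigma u *: p); rewrite sz.
  split=> // [|w].
    by rewrite card_spanK_consr // cx /= -expnS prednK.
  rewrite sev_twist subr_eq0; apply/idP/spanK_consrP => [/eqP E|[b Kb]].
    have Kwu : sigma (sev p w / u) = sev p w / u.
      rewrite fmorph_div; apply: (mulfI u0); rewrite mulrA E.
      by field; rewrite u0 su0.
    by exists (sev p w / u); rewrite // -px sevB sev_fixM // divfK ?subrr.
  rewrite -px sevB sev_fixM // subr_eq0 => /eqP ->.
  by rewrite rmorphM /= Kb -/u; apply/eqP; ring.
exists 1; rewrite size_poly1; split=> // [|w].
  have -> : spanK x = [set 0].
    apply/setP=> w; rewrite inE; apply/spanKP/eqP => [[c _ ->]|->].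
      by rewrite big_ord0.
    by exists 0 => [[]|]//; rewrite big_ord0.
  by rewrite cards1 expn0.
rewrite /sev size_poly1 big_ord1 coef1 mul1r; apply/eqP/spanKP => /= [->|[c _ ->]].
  by exists 0 => [[]|]//; rewrite big_ord0.
by rewrite big_ord0.
Qed.

Lemma fixK_gt1 : (1 < q)%N.
Proof.
rewrite (cardsD1 0) (cardsD1 1) !inE rmorph0 rmorph1 !eqxx oner_eq0.
by [].
Qed.

Lemma card_spanK k (x : 'rV_k) : exists2 r, (r <= k)%N & #|spanK x| = (q ^ r)%N.
Proof.
have [p [/andP[p0 pk] cx _]] := annihilator x.
by exists (size p).-1; rewrite // -ltnS prednK.
Qed.

(** * Counting vectors of given rank over the fixed field *)

Definition nb_rank k u := #|[set x : 'rV[F]_k | #|spanK x| == q ^ u]%N|.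

Lemma nb_rank0 u : nb_rank 0 u = (u == 0)%N.
Proof.
have E (x : 'rV[F]_0) : (#|spanK x| == q ^ u)%N = (u == 0)%N.
  have [r] := card_spanK x; rewrite leqn0 => /eqP-> ->.
  by rewrite eqn_exp2l ?fixK_gt1 // eq_sym.
transitivity #|[set x : 'rV[F]_0 | u == 0]%N|.
  by apply: eq_card => x; rewrite !inE E.
case: eqP => _; last by apply: eq_card0 => x; rewrite inE.
rewrite (eq_card (B := 'rV[F]_0)) ?card_mx // => x; by rewrite !inE.
Qed.

Lemma nb_rank_consr k u : nb_rank k.+1 u =
  (\sum_(x : 'rV[F]_k) #|[set a | #|spanK (consr a x)| == q ^ u]%N|)%N.
Proof.
rewrite /nb_rank -[LHS]sum1dep_card big_mkcond sum_rV_consr.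
by apply: eq_bigr => x _; rewrite -[RHS]sum1dep_card [RHS]big_mkcond.
Qed.

(** The [q ^ r] entries inside the span keep the rank; all the others raise it by one. *)
Lemma card_rank_consr k (x : 'rV_k) r u : #|spanK x| = (q ^ r)%N ->
  #|[set a | #|spanK (consr a x)| == q ^ u]%N| =
  ((r == u) * q ^ u + (r.+1 == u) * (#|F| - q ^ r))%N.
Proof.
move=> cx; have -> : (#|F| - q ^ r = #|~: spanK x|)%N.
  by rewrite -cx -(cardsC (spanK x)) addKn.
rewrite -[LHS]sum1dep_card big_mkcond (bigID [in spanK x]) /=; congr (_ + _)%N.
  rewrite (eq_bigr (fun=> (r == u) : nat)) => [|a xa].
    by rewrite sum_nat_const cx mulnC; case: eqP => [->|].
  by rewrite spanK_consr_in // cx eqn_exp2l ?fixK_gt1 //.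
rewrite (eq_bigr (fun=> (r.+1 == u) : nat)) => [|a xa].
  rewrite sum_nat_const mulnC; congr (_ * _)%N.
  by apply: eq_card => a; rewrite !inE.
by rewrite card_spanK_consr // cx -expnS eqn_exp2l ?fixK_gt1.
Qed.

Lemma nb_rankS0 k : nb_rank k.+1 0 = nb_rank k 0.
Proof.
rewrite nb_rank_consr /nb_rank -[RHS]sum1dep_card [RHS]big_mkcond.
apply: eq_bigr => x _; have [r _ cx] := card_spanK x.
rewrite (card_rank_consr _ cx) cx eqn_exp2l ?fixK_gt1 //.
by case: eqP.
Qed.

Lemma nb_rankSS k u : nb_rank k.+1 u.+1 =
  (nb_rank k u.+1 * q ^ u.+1 + nb_rank k u * (#|F| - q ^ u))%N.
Proof.
rewrite nb_rank_consr /nb_rank -!sum_nat_const [X in _ = (X + _)%N]big_mkcond.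
rewrite [X in _ = (_ + X)%N]big_mkcond -big_split.
apply: eq_bigr => x _ /=; have [r _ cx] := card_spanK x.
rewrite (card_rank_consr _ cx) !inE cx !eqn_exp2l ?fixK_gt1 // eqSS.
by do 2!case: eqP => [->|] //; rewrite ?mul1n ?mul0n.
Qed.

Lemma nb_rankE k u :
  (nb_rank k u)%:R =
  gauss_binom q k u * \prod_(j < u) (#|F|%:R - (q ^ j)%:R) :> rat.
Proof.
elim: k u => [|k IH] [|u].
- by rewrite nb_rank0 gauss_binom0 big_ord0 mulr1.
- by rewrite nb_rank0 gauss_binom_small // mul0r.
- by rewrite nb_rankS0 IH !gauss_binom0.
rewrite nb_rankSS natrD !natrM gauss_binomSS ?fixK_gt1 // IH mulrDl.
congr (_ + _); first by rewrite [LHS]mulrC mulrA.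
(* The truncated subtraction is harmful only if [q ^ u] exceeds [#|F|]; then no span has [q ^ u]
   elements and both terms vanish. *)
have [uF|Fu] := leqP (q ^ u) #|F|.
  by rewrite natrB // IH big_ord_recr mulrA.
suff nb0 : nb_rank k u = 0%N.
  by rewrite nb0 mul0r big_ord_recr mulrA /= -IH nb0 mul0r.
apply: eq_card0 => x; rewrite inE; apply/negP => /eqP cx.
by have := max_card [in spanK x]; rewrite cx leqNgt Fu.
Qed.

(** * The twisted alternating forms *)

(** This is $\sigma^s(B_{t-s})$; two indices avoid negative powers of [sigma]. *)
Definition twist s t k (x y : 'rV[F]_k) : F :=
  \sum_l (iter s sigma (x 0 l) * iter t sigma (y 0 l)
          - iter s sigma (y 0 l) * iter t sigma (x 0 l)).

Lemma twist_consr s t k a b (x y : 'rV_k) :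
  twist s t (consr a x) (consr b y) =
  iter s sigma a * iter t sigma b - iter s sigma b * iter t sigma a + twist s t x y.
Proof.
rewrite /twist big_ord_recl !consr0; congr (_ + _).
by apply: eq_bigr => l _; rewrite !consr_lift.
Qed.

(** Shifting [y] along [c] has the same effect as prepending the pair [(v, w)]; compare
    [twist_consr]. *)
Lemma twist_shift s t k (x y c : 'rV_k) w : (forall l, sigma (c 0 l) = c 0 l) ->
  let v := \sum_l c 0 l * x 0 l in
  twist s t x (y + w *: c) =
  iter s sigma v * iter t sigma w - iter s sigma w * iter t sigma v + twist s t x y.
Proof.
move=> Kc; rewrite /= !rmorph_sum mulr_suml mulr_sumr -sumrB -big_split.
apply: eq_bigr => l _; rewrite !mxE !rmorphD !rmorphM /= !(iter_fixK _ (Kc l)).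
by ring.
Qed.

Lemma twist_iter u s t k (x y : 'rV_k) :
  iter u sigma (twist s t x y) = twist (u + s) (u + t) x y.
Proof.
rewrite rmorph_sum; apply: eq_bigr => l _.
by rewrite rmorphB !rmorphM /= -!iterD.
Qed.

Lemma twistC s t k (x y : 'rV_k) : twist s t x y = - twist t s x y.
Proof.
rewrite /twist -sumrN; apply: eq_bigr => l _.
by rewrite opprB [X in X - _]mulrC [X in _ - X]mulrC.
Qed.

(** The sum expands into a combination of the [twist i j x y] with coefficients [P_i Q_j]. *)
Lemma twist_sev k (x y : 'rV_k) (P Q : {poly F}) :
  (forall s t, twist s t x y = 0) ->
  \sum_l (sev P (x 0 l) * sev Q (y 0 l) - sev P (y 0 l) * sev Q (x 0 l)) = 0.
Proof.
move=> xy0.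
transitivity (\sum_(i < size P) \sum_(j < size Q) P`_i * Q`_j * twist i j x y).
  under [RHS]eq_bigr => i _ do
    (under eq_bigr => j _ do rewrite mulr_sumr; rewrite exchange_big).
  rewrite exchange_big; apply: eq_bigr => l _ /=.
  rewrite !mulr_suml -sumrB; apply: eq_bigr => i _.
  rewrite !mulr_sumr -sumrB; apply: eq_bigr => j _.
  by ring.
by rewrite big1 // => i _; rewrite big1 // => j _; rewrite xy0 mulr0.
Qed.

(* A skew polynomial of degree [r <= 2 k] killing all entries of [x] and [y]
   makes [twist 0] satisfy a linear recurrence of order [r]. *)
Lemma twist_recurrence k (x y : 'rV_k) a :
  (forall j, (j < k + k)%N -> twist 0 (a + j) x y = 0) ->
  forall j, twist 0 (a + j) x y = 0.
Proof.
move=> win; have [p [/andP[p0 pk] _ pxy]] := annihilator (row_mx x y).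
have px l : sev p (x 0 l) = 0.
  by apply/eqP; rewrite pxy -(row_mxEl x y) mem_spanK.
have py l : sev p (y 0 l) = 0.
  by apply/eqP; rewrite pxy -(row_mxEr x y) mem_spanK.
elim/ltn_ind=> j IH; have [|kj] := ltnP j (k + k); first exact: win.
pose r := (size p).-1; have sz : size p = r.+1 by rewrite prednK.
have rj : (r <= j)%N by rewrite (leq_trans _ kj) // -ltnS -sz.
(* Chosen so that the top index [b + r] of the recurrence is [a + j]. *)
pose b := (a + (j - r))%N.
have rec : \sum_(i < r.+1) iter b sigma p`_i * twist 0 (b + i) x y = 0.
  transitivity (\sum_l (x 0 l * iter b sigma (sev p (y 0 l))
                        - y 0 l * iter b sigma (sev p (x 0 l)))).
    under eq_bigr => i _ do rewrite mulr_sumr.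
    rewrite exchange_big; apply: eq_bigr => l _ /=.
    rewrite /sev sz !rmorph_sum !mulr_sumr -sumrB; apply: eq_bigr => i _.
    by rewrite !rmorphM /= -!iterD; ring.
  by rewrite big1 // => l _; rewrite px py rmorph0 !mulr0 subrr.
move: rec; rewrite big_ord_recr big1 /= => [|i _]; last first.
  by rewrite /b -addnA IH ?mulr0 //; have := ltn_ord i; lia.
rewrite add0r /b -addnA subnK // => /eqP; rewrite mulf_eq0 fmorph_eq0.
by rewrite -/(lead_coef p) lead_coef_eq0 -size_poly_eq0 sz => /eqP.
Qed.

(** * Counting the pairs on which all the forms vanish *)

Variable N : nat.
Hypotheses (N_gt0 : (0 < N)%N) (sigmaN : iter N sigma =1 id).

Lemma iter_period t j w : iter (t + j * N) sigma w = iter t sigma w.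
Proof. by elim: j => [|j IH]; rewrite ?addn0 // mulSn addnCA iterD sigmaN. Qed.

Lemma twist_period s t j k (x y : 'rV_k) :
  twist s (t + j * N) x y = twist s t x y.
Proof. by apply: eq_bigr => l _; rewrite !iter_period. Qed.

Definition isotropic k (x y : 'rV[F]_k) := [forall t : 'I_N, twist 0 t x y == 0].

Lemma isotropicP k (x y : 'rV_k) :
  reflect (forall s t, twist s t x y = 0) (isotropic x y).
Proof.
apply: (iffP forallP) => [xy0 s t|xy0 t]; last by rewrite xy0.
(* Adding [s * N], a multiple of the period, keeps the index difference nonnegative. *)
have -> : twist s t x y = iter s sigma (twist 0 (t + s * N - s) x y).
  rewrite twist_iter addn0 subnKC ?twist_period //.
  by rewrite (leq_trans _ (leq_addl _ _)) // leq_pmulr.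
rewrite {1}(divn_eq (t + s * N - s) N) addnC twist_period.
by rewrite (eqP (xy0 (Ordinal (ltn_pmod _ N_gt0)))) rmorph0.
Qed.

Lemma isotropic_window a k (x y : 'rV_k) :
  (forall j, (j < k + k)%N -> twist 0 (a + j) x y = 0) -> isotropic x y.
Proof.
move=> win; apply/forallP=> t; rewrite -(twist_period _ _ a).
have aN : (a <= t + a * N)%N by rewrite (leq_trans _ (leq_addl _ _)) // leq_pmulr.
by rewrite -(subnKC aN) twist_recurrence.
Qed.

Definition nb_isotropic k (x : 'rV[F]_k) := #|[set y | isotropic x y]|.

(** If [(a, b)] contributes as [(v, w)] does, the translation of [y] by [w *: c] matches the two
    solution sets. *)
Lemma card_isotropic_consr k a b (x c : 'rV_k) w :
  (forall l, sigma (c 0 l) = c 0 l) ->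
  let v := \sum_l c 0 l * x 0 l in
  (forall s t, iter s sigma a * iter t sigma b - iter s sigma b * iter t sigma a =
     iter s sigma v * iter t sigma w - iter s sigma w * iter t sigma v) ->
  #|[set y | isotropic (consr a x) (consr b y)]| = nb_isotropic x.
Proof.
move=> Kc v E; have inj : injective (fun y : 'rV_k => y + w *: c) by exact: addIr.
rewrite /nb_isotropic -[RHS](card_preimset _ inj); apply: eq_card => y; rewrite !inE.
apply/isotropicP/isotropicP => xy0 s t.
  by rewrite twist_shift // -E -twist_consr.
by rewrite twist_consr E -twist_shift.
Qed.

Lemma nb_isotropic_consr k a (x : 'rV_k) :
  nb_isotropic (consr a x) =
  (\sum_b #|[set y | isotropic (consr a x) (consr b y)]|)%N.
Proof.
rewrite /nb_isotropic -sum1_card big_mkcond sum_rV_consr exchange_big /=.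
apply: eq_bigr => b _; rewrite -sum1_card [RHS]big_mkcond.
by apply: eq_bigr => y _; rewrite !inE.
Qed.

(** Here [a] itself is the combination [v], so every [b] is absorbed with [w = b]. *)
Lemma nb_isotropic_in k a (x : 'rV_k) : a \in spanK x ->
  nb_isotropic (consr a x) = (#|F| * nb_isotropic x)%N.
Proof.
move=> /spanKP[c Kc ac]; rewrite nb_isotropic_consr -sum_nat_const.
apply: eq_bigr => b _; apply: (@card_isotropic_consr _ _ _ _ c b) => //.
by rewrite -ac.
Qed.

(* Solvability forces [b] into the span of [a] and [x]: pair the annihilator of
   that span with an operator killing [x] but not [a]. *)
Lemma isotropic_consr_span k a b (x y : 'rV_k) : a \notin spanK x ->
  isotropic (consr a x) (consr b y) -> b \in spanK (consr a x).
Proof.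
move=> xNa /isotropicP/twist_sev H.
have [P [_ _ PE]] := annihilator (consr a x).
have [Q [_ _ QE]] := annihilator x.
have Pa : sev P a = 0.
  by apply/eqP; rewrite PE; have := mem_spanK (consr a x) ord0; rewrite consr0.
have Px l : sev P (x 0 l) = 0.
  apply/eqP; rewrite PE; have := mem_spanK (consr a x) (lift ord0 l).
  by rewrite consr_lift.
have Qx l : sev Q (x 0 l) = 0 by apply/eqP; rewrite QE mem_spanK.
(* Only the first entry survives, leaving [sev P b * sev Q a = 0] up to sign, where [sev Q a] is
   nonzero. *)
have := H P Q; rewrite big_ord_recl !consr0 big1 => [|l _].
  rewrite Pa mul0r sub0r addr0 => /eqP; rewrite oppr_eq0 mulf_eq0 PE.
  by rewrite QE (negPf xNa) orbF.
by rewrite !consr_lift Px Qx mul0r mulr0 subr0.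
Qed.

Lemma nb_isotropic_notin k a (x : 'rV_k) : a \notin spanK x ->
  nb_isotropic (consr a x) = (#|spanK (consr a x)| * nb_isotropic x)%N.
Proof.
move=> xNa; rewrite nb_isotropic_consr -sum_nat_const [RHS]big_mkcond.
apply: eq_bigr => b _; case: ifP => [/spanK_consrP[f Kf /spanKP[c Kc bc]]|xNb].
  have Kc' l : sigma ((- c) 0 l) = (- c) 0 l by rewrite mxE rmorphN Kc.
  (* Write [b = f a + v] with [v] in the span of [x]. The pair [(a, f a)] contributes 0 as [f] is
     fixed, and [(a, v)] contributes as [(- v, a)]. *)
  apply: (@card_isotropic_consr _ _ _ _ (- c) a) => // s t.
  have -> : \sum_l (- c) 0 l * x 0 l = f * a - b.
    rewrite -opprB bc -sumrN; apply: eq_bigr => l _.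
    by rewrite mxE mulNr.
  by rewrite !rmorphB !rmorphM /= !(iter_fixK _ Kf); ring.
apply/eqP; rewrite cards_eq0; apply/eqP/setP=> y; rewrite !inE.
by apply/negP=> /(isotropic_consr_span xNa); rewrite xNb.
Qed.

(** An entry in the span of its successors contributes [#|F|]; one raising the rank to [j]
    contributes [q ^ j], and $1+\dots+r = \binom{r+1}{2}$. *)
Lemma nb_isotropicE k (x : 'rV_k) : exists2 r, (r <= k)%N &
  #|spanK x| = (q ^ r)%N /\
  nb_isotropic x = (#|F| ^ (k - r) * q ^ 'C(r.+1, 2))%N.
Proof.
elim: k x => [|k IH] x.
  exists 0%N => //; have [p [p01 -> _]] := annihilator x.
  split; first by case: (size p) p01 => [|[]].
  have -> : nb_isotropic x = #|[set: 'rV[F]_0]|.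
    apply: eq_card => y; rewrite !inE.
    by apply/isotropicP => s t; rewrite /twist big_ord0.
  by rewrite cardsT card_mx bin_small.
rewrite -[x]consr_eta; move: (x 0 ord0) (\row_l _) => a {}x.
have [r rk [cx nx]] := IH x; have [xa|xNa] := boolP (a \in spanK x).
  exists r; first exact: leqW.
  by rewrite spanK_consr_in // nb_isotropic_in // nx subSn // expnS mulnA.
exists r.+1; rewrite // nb_isotropic_notin // nx card_spanK_consr // cx -expnS.
by split=> //; rewrite subSS mulnCA -expnD [in RHS]binS bin1 addnC.
Qed.

Lemma card_isotropic k :
  #|[set z : 'rV[F]_k * 'rV[F]_k | isotropic z.1 z.2]| =
  (\sum_(u < k.+1) nb_rank k u * (#|F| ^ (k - u) * q ^ 'C(u.+1, 2)))%N.
Proof.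
transitivity (\sum_(x : 'rV_k) nb_isotropic x)%N.
  under [RHS]eq_bigr => x _ do rewrite /nb_isotropic -sum1_card big_mkcond.
  rewrite pair_bigA -sum1_card big_mkcond.
  by apply: eq_bigr => z _; rewrite !inE.
under [RHS]eq_bigr => u _ do rewrite -sum_nat_const big_mkcond.
rewrite exchange_big; apply: eq_bigr => x _ /=.
have [r rk [cx ->]] := nb_isotropicE x.
rewrite (bigD1 (Ordinal (rk : r < k.+1))%N) //= inE cx eqxx big1 ?addn0 // => u ur.
rewrite inE cx eqn_exp2l ?fixK_gt1 // eq_sym ifN //.
Qed.

End TwistedForms.

(** * Powers of the Frobenius *)

(** Since $n-1$ divides $n^h-1$, $X^n-X$ divides $X^{|F|}-X$, which splits with simple roots; so it
    has exactly [n] roots. *)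
Lemma card_exp_fixed (F : finFieldType) n h : (1 < n)%N -> #|F| = (n ^ h)%N ->
  #|[set a : F | a ^+ n == a]| = n.
Proof.
move=> n1 cF; have n0 := ltnW n1.
have dv : 'X^n - 'X %| \prod_(x : F) ('X - x%:P).
  rewrite -finField_genPoly.
  have XE N : (0 < N)%N -> ('X^N - 'X : {poly F}) = 'X * ('X^(N.-1) - 1).
    by move=> N0; rewrite mulrBr mulr1 -exprS prednK.
  rewrite !XE ?dvdp_mul2l ?polyX_eq0 //; last by rewrite cF expn_gt0 n0.
  have /dvdnP[c ->] : (n.-1 %| #|F|.-1)%N.
    by rewrite cF predn_exp dvdn_mulr.
  by rewrite mulnC exprM [X in _ %| X]subrX1 dvdp_mulr.
have [M pM] := dvdp_prod_XsubC dv.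
set r := mask M _ in pM.
have ur : uniq r by rewrite mask_uniq // index_enum_uniq.
have := eqp_size pM; rewrite size_prod_XsubC.
rewrite size_polyDl ?size_polyXn ?size_polyN ?size_polyX // => -[nr].
rewrite [RHS]nr -(card_uniqP ur); apply: eq_card => a; rewrite inE.
by rewrite -root_prod_XsubC -(eqp_root pM) rootE !hornerE subr_eq0.
Qed.

Lemma iter_pFrobenius (R : nzRingType) p (ch : p \in [pchar R]) t x :
  iter t (pFrobenius_aut ch) x = x ^+ (p ^ t).
Proof.
elim: t => [|t IH]; first by rewrite expn0 expr1.
by rewrite iterS IH pFrobenius_autE -exprM expnSr.
Qed.

Lemma expf_cardX (F : finFieldType) c (x : F) : x ^+ (#|F| ^ c) = x.
Proof. by elim: c => [|c IH]; rewrite ?expr1 // expnS exprM expf_card. Qed.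

(** By Bezout, being fixed by the Frobenius powers [d] and [m] amounts to being fixed by the power
    [gcdn d m]. *)
Lemma card_frob_fixK (F : finFieldType) m d (ch : 2 \in [pchar F]) :
  #|F| = (2 ^ m)%N -> (0 < d)%N ->
  #|fixK (iter d (pFrobenius_aut ch) : {rmorphism F -> F})| = (2 ^ gcdn d m)%N.
Proof.
move=> cF d0; have m0 : (0 < m)%N.
  by case: m cF (finNzRing_gt1 F) => // ->.
have e0 : (0 < gcdn d m)%N by rewrite gcdn_gt0 d0.
rewrite -[RHS](@card_exp_fixed F _ (m %/ gcdn d m)) ?(ltn_exp2l 0) //; last first.
  by rewrite -expnM mulnC divnK ?dvdn_gcdr.
have fixM t j (a : F) : a ^+ (2 ^ t) = a -> a ^+ (2 ^ (j * t)) = a.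
  move=> ta; elim: j => [|j IH]; first by rewrite expr1.
  by rewrite mulSn expnD exprM ta.
apply: eq_card => a; rewrite !inE /= iter_pFrobenius; apply/eqP/eqP => fa.
  have [km kn E _] := egcdnP m d0.
  have := fixM d km a fa; rewrite E expnD exprM fixM //.
  by rewrite -cF expf_card.
by rewrite -(divnK (dvdn_gcdl d m)) fixM.
Qed.

(** Adding [m * b] changes the Frobenius exponent by a multiple of [m] and makes it a natural
    number. *)
Lemma frob_expE (F : finFieldType) m n d e j b (x : F) :
  #|F| = (2 ^ m)%N -> (j <= n %/ e + m * b)%N ->
  x ^+ frob_exp m n d e j = x ^+ (2 ^ ((n %/ e + m * b - j) * d)).
Proof.
move=> cF jb; set T := (_ * d)%N.
have -> : frob_exp m n d e j = (2 ^ (T %% m))%N.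
  rewrite /frob_exp; congr (2 ^ _)%N.
  have -> : ((n %/ e)%:Z - j%:Z) * d%:Z = (- (b * d)%:Z) * m%:Z + T%:Z.
    by rewrite /T !PoszM -subzn // PoszD !PoszM; ring.
  by rewrite modzMDl modz_nat.
rewrite [in RHS](divn_eq T m) expnD exprM.
by rewrite mulnC expnM -cF expf_cardX.
Qed.

(** * From the system of equations to isotropic pairs *)

Section Deinterleave.
Variables (F : finFieldType) (i : nat).

Definition deinterleave (t : (2 * i).-tuple F) : 'rV[F]_i * 'rV[F]_i :=
  (\row_l t`_(2 * l), \row_l t`_(2 * l).+1).

Lemma deinterleave_bij : bijective deinterleave.
Proof.
apply: inj_card_bij => [t t' /pair_equal_spec[/rowP E /rowP O]|]; last first.
  by rewrite card_prod !card_mx card_tuple mul1n -expnD addnn mul2n.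
apply/val_inj/(@eq_from_nth _ 0); rewrite !size_tuple // => j ji.
have j2 : (j./2 < i)%N by lia.
have := O (Ordinal j2); have := E (Ordinal j2); rewrite !mxE /= => Ej Oj.
by rewrite -(odd_double_half j) -mul2n; case: (odd j).
Qed.

End Deinterleave.

Lemma V_setE (F : finFieldType) (m n d e s i : nat) (ch : 2 \in [pchar F]) :
  #|F| = (2 ^ m)%N -> (0 < m)%N -> m = (2 * n)%N -> e = gcdn n d -> (i <= s)%N ->
  V_set F m n d e s i =
  @deinterleave F i @^-1: [set z | isotropic
     (iter d (pFrobenius_aut ch) : {rmorphism F -> F}) m z.1 z.2].
Proof.
move=> cF m0 mn edef is_.
set sigma := (X in isotropic X).
have sigmaE t x : iter t sigma x = x ^+ (2 ^ (t * d)).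
  by rewrite /sigma /= -iterM iter_pFrobenius.
have sigmaN : iter m sigma =1 id.
  by move=> x; rewrite sigmaE expnM -cF expf_cardX.
pose h := (n %/ e)%N.
(* As [2 * n = m], this gives $\sigma^{2h} = 1$. *)
have hd : ((h + h) * d = (d %/ e) * m)%N.
  have en : (e %| n)%N by rewrite edef dvdn_gcdl.
  have ed : (e %| d)%N by rewrite edef dvdn_gcdr.
  by rewrite -{1}(divnK ed) mulnCA -/h mulnDl addnn -mul2n /h divnK // -mn.
have sigma2h t x : iter (t + (h + h)) sigma x = iter t sigma x.
  by rewrite !sigmaE mulnDl hd expnD exprM (mulnC _ m) (expnM _ m) -cF expf_cardX.
(* In characteristic 2 the plus sign of [Qform] is the minus sign of [twist]. *)
have QE (t : (2 * i).-tuple F) j b : (j <= h + m * b)%N ->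
    Qform i t (frob_exp m n d e j) =
    twist sigma 0 (h + m * b - j) (deinterleave t).1 (deinterleave t).2.
  move=> jb; apply: eq_bigr => l _; rewrite !mxE /= !sigmaE (oppr_pchar2 ch).
  by rewrite !(frob_expE d _ cF jb) [X in _ + X]mulrC.
apply/setP=> t; rewrite !inE; set z := deinterleave t; apply/forallP/idP.
  move=> Vt.
  have Vt' j : (j <= s)%N -> twist sigma 0 (h + m * s - j) z.1 z.2 = 0.
    move=> js; rewrite -QE; last first.
      by rewrite (leq_trans js) // (leq_trans _ (leq_addl _ _)) // leq_pmull.
    exact/eqP/(Vt (Ordinal (js : j < s.+1)%N)).
  (* Modulo the period, the window of [2 * i] indices starts at [h - s] and stays within [h + s],
     because [i <= s]. *)
  apply: (@isotropic_window _ _ m m0 sigmaN (h + m * s - s)) => j jk.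
  have sms : (s <= m * s)%N by rewrite leq_pmull.
  have [js|sj] := leqP j s.
    have -> : (h + m * s - s + j = h + m * s - (s - j))%N by lia.
    exact/Vt'/leq_subr.
  have js : (j - s <= s)%N by lia.
  have -> : (h + m * s - s + j = h + m * s + (j - s))%N by lia.
  set u := (_ + (j - s))%N.
  (* Past [h], apply $\sigma^u$ to the equation for [h - (j - s)]: the second index becomes [2 * h]
     modulo the period, hence trivial, and antisymmetry gives index [u]. *)
  have := Vt' _ js; move/(congr1 (iter u sigma)); rewrite rmorph0 twist_iter addn0.
  have -> : (u + (h + m * s - (j - s)) = (0 + (s + s) * m) + (h + h))%N by rewrite /u; lia.
  rewrite twistC => /eqP; rewrite oppr_eq0 => /eqP <-.
  by apply: eq_bigr => l _; rewrite !sigma2h !(iter_period sigmaN).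
move=> /(isotropicP m0 sigmaN) iso j; rewrite (QE t j s) ?iso //.
have js : (j <= s)%N by rewrite -ltnS.
by rewrite (leq_trans js) // (leq_trans _ (leq_addl _ _)) ?leq_pmull.
Qed.

Theorem theorem6p4 (F : finFieldType) (m n d e s i : nat) :
  #|F| = (2 ^ m)%N ->
  (0 < m)%N -> (0 < n)%N -> (0 < d)%N -> (0 < e)%N ->
  m = (2 * n)%N -> e = gcdn n d -> e = gcdn m d ->
  (1 <= i)%N -> (i <= s)%N ->
  (#|V_set F m n d e s i|%:R : rat) =
    (2 ^ (m * i))%:R *
    \sum_(u < i.+1)
       (gauss_binom (2 ^ e) i u * (2 ^ (e * (u * u.+1) %/ 2))%:R *
        \prod_(j < u) (1 - (2%:R : rat) ^ ((e * j)%:Z - m%:Z))).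
Proof.
move=> cF m0 _ d0 _ mn end_ emd _ is_.
have ch : 2 \in [pchar F] by exact: card_finPcharP cF _.
have sigmaN : iter m (iter d (pFrobenius_aut ch)) =1 id.
  by move=> x; rewrite -iterM iter_pFrobenius expnM -cF expf_cardX.
rewrite (V_setE ch cF m0 mn end_ is_) on_card_preimset; last first.
  exact/onW_bij/deinterleave_bij.
rewrite card_isotropic // natr_sum mulr_sumr; apply: eq_bigr => u _.
rewrite natrM nb_rankE (card_frob_fixK ch cF d0) gcdnC -emd natrM.
have -> : ((2 ^ e) ^ 'C(u.+1, 2) = 2 ^ (e * (u * u.+1) %/ 2))%N.
  have <- : ('C(u.+1, 2) * 2 = u * u.+1)%N.
    by rewrite (bin_ffact u.+1 2) ffactnSr ffactn1 subn1 mulnC.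
  by rewrite -expnM mulnA mulnK.
have two0 : 2%:R != 0 :> rat by [].
(* Each factor is $2^m-2^{ej} = 2^m(1-2^{ej-m})$; the extracted $2^{mu}$ completes $2^{m(i-u)}$ to
   $2^{mi}$. *)
have -> : \prod_(j < u) (#|F|%:R - ((2 ^ e) ^ j)%:R) =
    (2 ^ (m * u))%:R * \prod_(j < u) (1 - (2%:R : rat) ^ ((e * j)%:Z - m%:Z)).
  have -> : (2 ^ (m * u))%:R = \prod_(j < u) (2 ^ m)%:R :> rat.
    by rewrite prodr_const card_ord expnM natrX.
  rewrite -big_split; apply: eq_bigr => j _ /=; rewrite mulrBr mulr1 cF expfzDr //.
  rewrite -expnM !natrX -exprnN -exprnP mulrCA.
  by rewrite divff ?mulr1 // expf_neq0.
rewrite cF -expnM; have -> : (m * i = m * (i - u) + m * u)%N.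
  by rewrite -mulnDr subnK // -ltnS.
by rewrite expnD natrM; ring.
Qed.
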